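(* Let $f=a_0+a_1z+\cdots+a_nz^n\in\mathbb{Z}[z]$ be a primitive polynomial with $a_0a_n\neq 0$. Suppose there exists a positive integer $m\geq h_f+2$ for which $s_n(m)=\pm p_1^{k_1}\cdots p_r^{k_r}$, where $k_1,\ldots,k_r$ are positive integers and $p_1,\ldots,p_r$ are primes which are pairwise distinct when $r\geq 2$. Suppose that for each $i=1,\ldots,r$ there is a positive integer $j_i\leq n$ such that: (i) $v_{p_i}(s_{n-j_i}(m))=0$ and $\gcd(k_i,j_i)=1$; (ii) if $j_i>1$, then $\frac{k_i}{j_i}<\frac{v_{p_i}(s_{n-t}(m))}{j_i-t}$ for each $t=1,\ldots,j_i-1$; (iii) $|s_0(m)/q|\leq |s_n(m)|$, where $q$ is the smallest prime divisor of $|s_0(m)|$. Then $f$ is a product of at most $r$ irreducible polynomials in $\mathbb{Z}[z]$. In particular, if $r=1$, then $f$ is irreducible in $\mathbb{Z}[z]$.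
   Context: For $f=a_0+\cdots+a_nz^n$ with $a_n\neq0$, the height is $h_f=\max_{0\leq i\leq n-1}|a_i|/|a_n|$. For $i=0,1,\ldots,n$, $s_i(z)=f^{(i)}(z)/i!\in\mathbb{Z}[z]$, where $f^{(i)}$ is the $i$-th formal derivative (so $s_0=f$ and $s_n=a_n$). A polynomial is primitive if the gcd of its coefficients is $1$. For a prime $p$ and nonzero integer $a$, $v_p(a)$ is the exponent of $p$ in $a$, and $v_p(0)=\infty$. *)

(* Defs.v *)
From mathcomp Require Import all_boot all_order all_algebra.
From mathcomp Require Import constructive_ereal.

Set Implicit Arguments.
Unset Strict Implicit.
Unset Printing Implicit Defensive.

Import Order.TTheory GRing.Theory Num.Theory.
Local Open Scope ring_scope.

(* Bounded maximum over the non-leading coefficients; the neutral element 0 is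
   harmless because all the ratios are nonnegative. *)
Definition height (f : {poly int}) : rat :=
  \big[Num.max/0]_(i < (size f).-1) (`|f`_i|%:~R / `|lead_coef f|%:~R).

(* [zcontents f] is the gcd of the coefficients up to the sign of the leading
   coefficient, whence the absolute value. *)
Definition primitive_poly (f : {poly int}) : Prop := `|zcontents f|%N = 1%N.

(* The p-adic valuation for prime p, with values in the extended rationals so
   that v_p(0) = +oo can be divided by a positive integer and compared. *)
Definition vp (p : nat) (a : int) : \bar rat :=
  if a == 0 then +oo%E else ((logn p `|a|%N)%:R)%:E.

(* Ring-theoretic irreducibility: MathComp's [irreducible_poly] uses
   pseudo-division, hence over int it ignores constant factors, i.e. it is
   irreducibility over the fraction field. *)
Definition irreducible_elt (R : idomainType) (x : R) : Prop :=
  [/\ x != 0, x \isn't a GRing.unit &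
      forall a b : R, x = a * b ->
        a \is a GRing.unit \/ b \is a GRing.unit].

(* Main.v *)
Require Import Defs.
From Stdlib Require Import Classical.
From mathcomp Require Import all_boot all_order all_algebra.
From mathcomp Require Import constructive_ereal algC zify.

Set Implicit Arguments.
Unset Strict Implicit.
Unset Printing Implicit Defensive.

Import Order.TTheory GRing.Theory Num.Theory.
Local Open Scope ring_scope.

(* The hypotheses say that the Newton polygon of f(z + m) at each p_i ends with
   an edge of slope k_i / j_i in lowest terms.  Such an edge cannot be shared
   between two factors, so in any factorization of f each p_i divides the leading
   coefficient of exactly one factor.  With more than r nonunit factors, some
   factor g therefore has leading coefficient +-1; write f = g h.  By Cauchy's
   bound all complex roots lie within distance < h_f + 1 <= m - 1 of 0, so a
   nonconstant factor is larger at m than its leading coefficient: |g(m)| > 1,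
   hence |g(m)| >= q, and |h(m)| > |a_n|, contradicting |f(m)| <= q |a_n|.  Since
   factorizations into nonunits have at most r terms, one that cannot be refined
   exists, and its factors are irreducible. *)

(** * Newton polygon of a product *)

(* Junk value: [vcoef p A i = 0] when the coefficient vanishes, hence the
   nonvanishing side conditions below. *)
Definition vcoef (p : nat) (A : {poly int}) (i : nat) : nat := logn p (absz A`_i).

(* The weight [j * v i - k * i] is minimised, with both sides moved to stay in
   [nat]; [s] is the first minimiser. *)
Lemma min_weight_index (A : {poly int}) (v : nat -> nat) (j k : nat) :
  A != 0 -> exists s, [/\ A`_s != 0,
    forall i, A`_i != 0 -> (j * v s + k * i <= j * v i + k * s)%N &
    forall i, (i < s)%N -> A`_i != 0 ->
      (j * v s + k * i < j * v i + k * s)%N].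
Proof.
move=> A0.
have A_lt i : A`_i != 0 -> (i < size A)%N.
  by apply: contra_neqT; rewrite -leqNgt => /(nth_default 0).
(* Adding the constant [k * size A] keeps the weight in [nat] for every [i] in range. *)
pose w i := (j * v i + k * (size A - i))%N.
pose P e := has (fun i => (A`_i != 0) && (w i == e)) (iota 0 (size A)).
have exP : exists e, P e.
  exists (w (size A).-1); apply/hasP; exists (size A).-1.
    by rewrite mem_iota /= add0n prednK ?lt0n ?size_poly_eq0.
  by rewrite eqxx andbT -lead_coefE lead_coef_eq0.
case: (ex_minnP exP) => e Pe min_e.
have ex_s : exists s, (A`_s != 0) && (w s == e).
  by case/hasP: Pe => s _ Ps; exists s.
case: (ex_minnP ex_s) => s /andP[As /eqP ws] min_s.
have w_ge i : A`_i != 0 -> (e <= w i)%N.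
  move=> Ai; apply: min_e; apply/hasP; exists i; rewrite ?Ai ?eqxx //.
  by rewrite mem_iota /= add0n A_lt.
have sA := A_lt _ As.
exists s; split=> // i.
  by move=> Ai; have := w_ge _ Ai; have := A_lt _ Ai; rewrite -ws /w; nia.
move=> lt_is Ai; have := w_ge _ Ai; have := A_lt _ Ai.
have : w i != e by apply: contraL lt_is => wi; rewrite -leqNgt min_s ?Ai.
by rewrite -ws /w; nia.
Qed.

(* The term at the sum of the first minimisers of A and B cannot be cancelled, so
   A * B reaches the sum of the two minimal weights. *)
Lemma weight_mul_attained (p j k : nat) (A B : {poly int}) :
    prime p -> (0 < j)%N -> A != 0 -> B != 0 ->
  exists2 t, (A * B)`_t != 0 &
    forall i l, A`_i != 0 -> B`_l != 0 ->
      (j * vcoef p (A * B) t + k * (i + l)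
        <= j * (vcoef p A i + vcoef p B l) + k * t)%N.
Proof.
move=> p_pr j0 A0 B0; pose v (a : int) := logn p `|a|%N.
have [s [As sA1 sA2]] := min_weight_index (vcoef p A) j k A0.
have [u [Bu uB1 uB2]] := min_weight_index (vcoef p B) j k B0.
pose e := (vcoef p A s + vcoef p B u)%N.
have dvd_v (a : int) c : a != 0 -> (p ^ c %| `|a|)%N = (c <= v a)%N.
  by move=> a0; rewrite pfactor_dvdn // absz_gt0.
have v_e : v (A`_s * B`_u) = e by rewrite /v abszM lognM ?absz_gt0.
(* Any other pair with [i + l = s + u] has [i < s] or [l < u], where first minimality is strict, so
   its term has valuation above [e]. *)
have others : ((p ^ e.+1)%N %| (A * B)`_(s + u) - A`_s * B`_u)%Z.
  have lt_s : (s < (s + u).+1)%N by lia.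
  rewrite coefM (bigD1 (Ordinal lt_s)) //= addKn addrC addrK.
  apply: rpred_sum => /= -[i lt_i] /= ne_i.
  have ne_is : i != s by apply: contra ne_i => /eqP ?; apply/eqP/val_inj.
  have [l def_l sum_il] : exists2 l, (s + u - i = l)%N & (i + l = s + u)%N.
    by exists (s + u - i)%N; lia.
  rewrite def_l; have [->|Ai] := eqVneq A`_i 0; first by rewrite mul0r dvdz0.
  have [->|Bl] := eqVneq B`_l 0; first by rewrite mulr0 dvdz0.
  rewrite dvdzE absz_nat dvd_v ?mulf_neq0 //.
  rewrite /v abszM lognM ?absz_gt0 // -/(vcoef p A i) -/(vcoef p B l).
  have k_il : (k * i + k * l = k * s + k * u)%N by rewrite -!mulnDr sum_il.
  rewrite -(ltn_pmul2l j0) !mulnDr.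
  have := sA1 _ Ai; have := uB1 _ Bl.
  case: (ltngtP i s) ne_is => // lt_is _.
    by have := sA2 _ lt_is Ai; lia.
  have lt_lu : (l < u)%N by lia.
  by have := uB2 _ lt_lu Bl; lia.
have ndiv : ~~ ((p ^ e.+1)%N %| (A * B)`_(s + u))%Z.
  apply/negP => dvd; have := rpredB dvd others.
  rewrite opprB addrC subrK dvdzE absz_nat dvd_v ?mulf_neq0 // v_e.
  by rewrite ltnn.
have AB0 : (A * B)`_(s + u) != 0 by apply: contra ndiv => /eqP->.
have v_le : (vcoef p (A * B) (s + u) <= e)%N.
  by rewrite dvdzE absz_nat dvd_v // -leqNgt in ndiv.
exists (s + u)%N => // i l Ai Bl.
have := sA1 _ Ai; have := uB1 _ Bl; move: v_le.
by rewrite -(leq_pmul2l j0) /e !mulnDr; lia.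
Qed.

(** Dumas's argument: the points [(i, vcoef p (A * B) i)] lie on or above the segment from
    [(n - j, 0)] to [(n, k)]. Coprimality leaves it no interior lattice point at which to be cut
    into an edge of [A] and one of [B]. *)
Lemma newton_edge_unsplittable (p j k n : nat) (A B : {poly int}) :
    prime p -> (0 < j <= n)%N -> (0 < k)%N -> coprime k j ->
    size (A * B) = n.+1 -> logn p (absz (lead_coef (A * B))) = k ->
    ~~ (p%:Z %| (A * B)`_(n - j))%Z ->
    (forall i, (A * B)`_i != 0 ->
       (j * k + k * i <= j * vcoef p (A * B) i + k * n)%N) ->
  ~ ((p%:Z %| lead_coef A)%Z /\ (p%:Z %| lead_coef B)%Z).
Proof.
move=> p_pr /andP[j0 jn] k0 co_kj sAB vAB ndiv w_ge [pA pB].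
have AB0 : A * B != 0 by rewrite -size_poly_eq0 sAB.
have /andP[A0 B0] : (A != 0) && (B != 0).
  by move: AB0; rewrite mulf_eq0 negb_or.
have [t ABt t_min] := weight_mul_attained k p_pr j0 A0 B0.
have := w_ge _ ABt; set vt := vcoef p _ _ in t_min * => ge_t.
have lA0 : lead_coef A != 0 by rewrite lead_coef_eq0.
have lB0 : lead_coef B != 0 by rewrite lead_coef_eq0.
have v_gt0 a : a != 0 -> (p%:Z %| a)%Z -> (0 < logn p `|a|)%N.
  by move=> a0; rewrite dvdzE absz_nat -{1}(expn1 p) pfactor_dvdn // absz_gt0.
have x0 := v_gt0 _ lA0 pA; have y0 := v_gt0 _ lB0 pB.
move: vAB; rewrite lead_coefM abszM lognM ?absz_gt0 // => vAB.
(* A and B each start at a coefficient prime to p and end at a leading coefficient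
   divisible by p; unless both chords have slope exactly k / j, one of them dips
   below the edge, and so does A * B. As k / j is in lowest terms, equality
   forces one chord to be the whole edge. *)
have [s [u [su ndA ndB]]] : exists s, exists u,
    [/\ (s + u = n - j)%N, ~~ (p%:Z %| A`_s)%Z & ~~ (p%:Z %| B`_u)%Z].
  have : ~~ [forall i : 'I_(n - j).+1,
      (p%:Z %| A`_i)%Z || (p%:Z %| B`_(n - j - i))%Z].
    apply: contra ndiv => /forallP dvd_i; rewrite coefM.
    by apply: rpred_sum => i _; case/orP: (dvd_i i) => ?;
      [apply: dvdz_mulr | apply: dvdz_mull].
  case/forallPn => i; rewrite negb_or => /andP[? ?].
  by exists i, (n - j - i)%N; split=> //; rewrite subnKC // -ltnS ltn_ord.
have nz_ndvd (a : int) : ~~ (p%:Z %| a)%Z -> a != 0 /\ logn p `|a| = 0%N.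
  move=> nd; split; first by apply: contra nd => /eqP->.
  by apply: logn_coprime; rewrite prime_coprime.
have [As vs] := nz_ndvd _ ndA; have [Bu vu] := nz_ndvd _ ndB.
clear nz_ndvd v_gt0 ndA ndB ndiv pA pB.
have le_size (C : {poly int}) i : C`_i != 0 -> (i <= (size C).-1)%N.
  apply: contra_neqT; rewrite -ltnNge => lt_i; apply: nth_default.
  by case: (size C) lt_i.
have sA := le_size _ _ As; have uB := le_size _ _ Bu.
have deg_n : ((size A).-1 + (size B).-1 = n)%N.
  have := sAB; rewrite size_mul //.
  move: A0 B0; rewrite -!size_poly_gt0.
  by case: (size A) (size B) => // a [] // b _ _; rewrite addSn addnS => -[].
(* Pairing the start of one chord with the end of the other and using [ge_t] gives
   [j * x <= k * (deg A - s)] and [j * y <= k * (deg B - u)]. Both sides sum to [j * k], so both are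
   equalities. *)
have t1 := t_min s (size B).-1 As lB0.
have t2 := t_min (size A).-1 u lA0 Bu.
rewrite /vcoef -!lead_coefE vs add0n in t1; rewrite /vcoef -!lead_coefE vu addn0 in t2.
move: (logn p (absz (lead_coef A))) (logn p (absz (lead_coef B))) x0 y0 vAB t1 t2.
move=> x y x0 y0 vAB t1 t2.
have eq_slope : (j * x = k * ((size A).-1 - s))%N.
  have : (k * ((size A).-1 - s) + k * s = k * (size A).-1)%N by rewrite -mulnDr subnK.
  have : (k * u + k * s + k * j = k * n)%N by rewrite -!mulnDr; congr muln; lia.
  have : (k * (size A).-1 + k * (size B).-1 = k * n)%N by rewrite -mulnDr deg_n.
  have : (j * x + j * y = j * k)%N by rewrite -mulnDr vAB.
  rewrite ?mulnDr in t1 t2 *; rewrite (mulnC j k) in ge_t *.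
  by lia.
have j_dvd : (j %| (size A).-1 - s)%N.
  have /Gauss_dvdr <- : coprime j k by rewrite coprime_sym.
  by rewrite -eq_slope dvdn_mulr.
case/dvdnP: j_dvd => c def_c; rewrite def_c in eq_slope.
have : x = (k * c)%N.
  by apply/eqP; rewrite -(eqn_pmul2l j0) eq_slope (mulnC c) mulnCA.
(* [c = 0] contradicts [0 < x]; [c >= 1] gives [x >= k], against [x + y = k] and [0 < y]. *)
by case: c {eq_slope def_c} => [|c]; rewrite ?muln0 ?mulnS; lia.
Qed.

(** * Root bound and values at [m] *)

(** If [H <= |x| - 1], the lower terms total at most [L * (|x| - 1)] times a geometric sum, that is
    [L * (|x| ^+ n - 1)], too little to cancel the leading term. *)
Lemma cauchy_root_bound (C : numFieldType) (F : {poly C}) (H x : C) :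
    0 < H -> F != 0 ->
    (forall i, (i < (size F).-1)%N -> `|F`_i| <= H * `|lead_coef F|) ->
  root F x -> `|x| < H + 1.
Proof.
move=> H0 F0 coef_le /rootP Fx.
(* The order on [C] is partial, so negating [<] requires real sides. *)
have realH1 : H + 1 \is Num.real by rewrite realD ?gtr0_real.
rewrite real_ltNge ?normr_real //; apply/negP => H1x.
set L := `|lead_coef F| in coef_le; set n := (size F).-1 in coef_le.
have L0 : 0 < L by rewrite normr_gt0 lead_coef_eq0.
have szF : size F = n.+1 by rewrite prednK ?size_poly_gt0.
have := Fx; rewrite horner_coef szF big_ord_recr /= -lead_coefE => /eqP.
rewrite addrC addr_eq0 => /eqP/(congr1 Num.norm).
rewrite normrN normrM normrX -/L => eqL.
have : L * `|x| ^+ n <= L * (`|x| ^+ n - 1).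
  rewrite eqL subrX1 mulrA mulr_sumr; apply: le_trans (ler_norm_sum _ _ _) _.
  apply: ler_sum => i _; rewrite normrM normrX ler_wpM2r ?exprn_ge0 //.
  apply: le_trans (coef_le _ (ltn_ord i)) _.
  by rewrite mulrC ler_pM2l // lerBrDr.
by rewrite ler_pM2l // lerDl oppr_ge0 ler10.
Qed.

Lemma coef_le_height (f : {poly int}) (i : nat) : f != 0 ->
  (i < (size f).-1)%N -> `|f`_i|%:~R <= height f * `|lead_coef f|%:~R.
Proof.
move=> f0 lt_i; rewrite -ler_pdivrMr ?ltr0z ?normr_gt0 ?lead_coef_eq0 //.
exact: (le_bigmax 0 (fun i : 'I__ => `|f`_i|%:~R / `|lead_coef f|%:~R : rat)
  (Ordinal lt_i)).
Qed.

Lemma height_gt0 (f : {poly int}) : f`_0 != 0 -> (1 < size f)%N -> 0 < height f.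
Proof.
move=> a0 sf; have f0 : f != 0 by rewrite -size_poly_gt0 ltnW.
have lt0 : (0 < (size f).-1)%N by case: (size f) sf.
have := coef_le_height f0 lt0; apply: contraTT; rewrite -!leNgt -ltNge => h0.
apply: (@le_lt_trans _ _ 0); last by rewrite ltr0z normr_gt0.
by rewrite mulr_le0_ge0 // ler0z.
Qed.

Lemma prodr_gt1_norm (R : numDomainType) (I : eqType) (s : seq I) (F : I -> R) :
    s != [::] -> (forall i, i \in s -> 1 < `|F i|) ->
  1 < `|\prod_(i <- s) F i|.
Proof.
elim: s => // x s IHs _ gt1; rewrite big_cons normrM.
have x1 := gt1 x (mem_head _ _).
have [-> | s0] := eqVneq s [::]; first by rewrite big_nil normr1 mulr1.
apply: mulr_egt1 x1 (IHs s0 _) => i si.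
by rewrite gt1 // inE si orbT.
Qed.

(** Over [algC], [|g(m)|] is [|lead_coef g|] times the product of [|m - z|] over the roots [z] of
    [g]. These are roots of [f], so each distance exceeds 1. *)
Lemma lead_lt_eval (f g h : {poly int}) (m : nat) :
    f = g * h -> f`_0 != 0 -> (1 < size g)%N -> height f + 2%:R <= m%:R ->
  `|lead_coef g| < `|g.[m%:Z]|.
Proof.
move=> def_f a0 sg m_ge; pose toC := map_poly (intr : int -> algC).
have f0 : f != 0 by apply: contraNneq a0 => ->; rewrite coef0.
have /andP[g0 h0] : (g != 0) && (h != 0).
  by move: f0; rewrite def_f mulf_eq0 negb_or.
have sf : (1 < size f)%N.
  rewrite def_f size_mul //; move: sg h0; rewrite -size_poly_gt0.
  by case: (size g) (size h) => [|[|a]] // [|b] // _ _; rewrite addSn addnS.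
have root_lt z : root (toC f) z -> `|z| < ratr (height f) + 1.
  apply: cauchy_root_bound; first by rewrite ltr0q height_gt0.
    by rewrite map_poly_eq0_id0 // intr_eq0 lead_coef_eq0.
  rewrite size_map_inj_poly ?lead_coef_map_inj //; try exact: intr_inj.
  move=> i lt_i; rewrite coef_map /=.
  have := coef_le_height f0 lt_i; rewrite -(ler_rat algC) rmorphM /=.
  by rewrite !ratr_int !intr_norm.
have m_gt z : root (toC f) z -> 1 < `|m%:R - z|.
  move=> /root_lt z_lt; have : ratr (height f) + 2%:R <= m%:R :> algC.
    by move: m_ge; rewrite -(ler_rat algC) rmorphD /= !ratr_nat.
  move=> m_geC; apply: lt_le_trans (lerB_dist _ _).
  rewrite normr_nat ltrBrDr; apply: lt_le_trans m_geC.
  by rewrite addrC -natr1 addrA ltrD2r.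
have [s def_g] := closed_field_poly_normal (toC g).
have lead_g : lead_coef (toC g) = (lead_coef g)%:~R.
  by rewrite lead_coef_map_inj //; exact: intr_inj.
have lg0 : 0 < `|(lead_coef g)%:~R : algC|.
  by rewrite normr_gt0 intr_eq0 lead_coef_eq0.
(* An empty product would only give equality. *)
have s_nil : s != [::].
  apply: contraTneq sg => s0; rewrite -(size_map_inj_poly (@intr_inj algC)) //.
  rewrite -/(toC g) def_g s0 big_nil -leqNgt.
  by rewrite (leq_trans (size_scale_leq _ _)) // size_poly1.
have root_s z : z \in s -> root (toC f) z.
  move=> sz; rewrite /toC def_f rmorphM /= rootM -/(toC g) def_g.
  by rewrite rootZ ?lead_g ?intr_eq0 ?lead_coef_eq0 // root_prod_XsubC sz.
rewrite -(ltr_int algC) !intr_norm.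
have -> : (g.[m%:Z])%:~R = (toC g).[m%:R] :> algC.
  by rewrite (pmulrn 1 m) /toC horner_map.
rewrite def_g hornerZ normrM lead_g ltr_pMr // horner_prod.
apply: prodr_gt1_norm => // z sz; rewrite hornerXsubC; exact/m_gt/root_s.
Qed.

(** * Taylor shift and valuations *)

(** Turns the hypotheses on the [s_i(m)] into hypotheses on the coefficients of [f(z + m)]. *)
Lemma coef_taylor_shift (R : comNzRingType) (f : {poly R}) (c : R) (i : nat) :
  (f \Po ('X + c%:P))`_i = f^`N(i).[c].
Proof.
(* Long enough for index [i] to occur in the Taylor sum even beyond the degree. *)
pose N := maxn (size f) i.+1.
rewrite /comp_poly addrC (@nderiv_taylor_wide _ N); last 2 first.
- exact: mulrC.
- by rewrite size_map_polyC leq_maxl.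
have lt_iN : (i < N)%N by rewrite leq_maxr.
rewrite coef_sum (bigD1 (Ordinal lt_iN)) //= big1 ?addr0 => [|l ne_l].
  by rewrite nderivn_map horner_map coefCM coefXn eqxx mulr1.
rewrite nderivn_map horner_map coefCM coefXn; case: eqP => [e|_]; last exact: mulr0.
by case/eqP: ne_l; apply: val_inj.
Qed.

Lemma vp_eq0_ndvd (q : nat) (a : int) : prime q -> vp q a = 0%E -> ~~ (q%:Z %| a)%Z.
Proof.
move=> q_pr; rewrite /vp; case: eqVneq => // a0 [] /eqP.
rewrite pnatr_eq0 => /eqP v0; rewrite dvdzE absz_nat -(expn1 q).
by rewrite pfactor_dvdn ?absz_gt0 // v0.
Qed.

Lemma vp_slope_lt (q k j t : nat) (a : int) :
    (0 < j)%N -> (0 < t)%N -> a != 0 ->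
    (k%:R%:E / j%:R%:E < vp q a / t%:R%:E :> \bar rat)%E ->
  (k * t < j * logn q `|a|)%N.
Proof.
move=> j0 t0 a0; rewrite /vp (negPf a0) !inver !pnatr_eq0 !gtn_eqF //.
rewrite -!EFinM lte_fin ltr_pdivrMr ?ltr0n // mulrAC ltr_pdivlMr ?ltr0n //.
by rewrite -!natrM ltr_nat mulnC [in X in (_ < X)%N]mulnC (mulnC t).
Qed.

Lemma logn_prime_power_prod (r : nat) (p k : 'I_r -> nat) (i : 'I_r) :
    (forall l, prime (p l)) -> injective p ->
  logn (p i) (\prod_(l < r) p l ^ k l)%N = k i.
Proof.
move=> p_pr p_inj; have pk_gt0 l : (0 < p l ^ k l)%N by rewrite expn_gt0 prime_gt0.
rewrite (bigD1 i) //= lognM ?prodn_cond_gt0 //.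
rewrite pfactorK // logn_coprime ?addn0 //.
elim/big_ind: _ => [|x y co_x co_y|l ne_li]; first exact: coprimen1.
  by rewrite coprimeMr co_x.
by rewrite coprimeXr // prime_coprime // dvdn_prime2 // (inj_eq p_inj) eq_sym.
Qed.

(** * Units and irreducible factorizations *)

Lemma absz_eq1_unit (c : int) : (`|c|%N == 1)%N -> c \is a GRing.unit.
Proof. by case: c => [[|[|]]|[|]]. Qed.

(** A constant factor divides the content of [f], hence is a unit by primitivity. *)
Lemma nonunit_factor_size (f g h : {poly int}) :
    primitive_poly f -> f = g * h -> g \isn't a GRing.unit -> (1 < size g)%N.
Proof.
move=> prim_f def_f; apply: contraR; rewrite -leqNgt => /size1_polyC def_g.
rewrite def_g poly_unitE coefC size_polyC /=.
have c1 : absz g`_0 == 1%N.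
  rewrite -dvdn1 -prim_f def_f zcontentsM abszM dvdn_mulr // {2}def_g.
  by rewrite -[_%:P]mulr1 mul_polyC zcontentsZ zcontents_monic ?monic1 // mulr1.
rewrite absz_eq1_unit // andbT.
by case: (eqVneq g`_0 0) c1 => [->|].
Qed.

(** Otherwise every factorization into nonunits has a factor that splits further, giving
    factorizations of every length, against [bound]. *)
Lemma irreducible_factorization (R : idomainType) (x : R) (r : nat) :
    x != 0 -> x \isn't a GRing.unit ->
    (forall s : seq R, x = \prod_(g <- s) g ->
       (forall g, g \in s -> g \isn't a GRing.unit) -> (size s <= r)%N) ->
  exists s : seq R, [/\ (size s <= r)%N,
    forall g, g \in s -> irreducible_elt g & x = \prod_(g <- s) g].
Proof.
move=> x0 xU bound; apply: NNPP => no_irr.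
suff /(_ r)[s [sz def_x sU]] : forall N, exists s : seq R,
    [/\ size s = N.+1, x = \prod_(g <- s) g &
        forall g, g \in s -> g \isn't a GRing.unit].
  by have := bound s def_x sU; rewrite sz ltnn.
elim=> [|N [s [sz def_x sU]]].
  exists [:: x]; split; rewrite ?big_seq1 // => g.
  by rewrite inE => /eqP->.
have not_irr : ~ forall g, g \in s -> irreducible_elt g.
  by move=> irr; apply: no_irr; exists s; split=> //; exact: bound.
have [g split_g] := not_all_ex_not _ _ not_irr.
have [sg nirr_g] := imply_to_and _ _ split_g.
have g0 : g != 0.
  by apply: contraNneq x0 => g0; rewrite def_x (big_rem g) //= g0 mul0r.
have [a [b [def_g aU bU]]] : exists a b : R,
    [/\ g = a * b, a \isn't a GRing.unit & b \isn't a GRing.unit].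
  apply: NNPP => no_split; apply: nirr_g; split=> //; first exact: sU.
  move=> a b def_g; have [|aU] := boolP (a \is a GRing.unit); first by left.
  right; apply: contraT => bU; case: no_split; by exists a, b.
exists (a :: b :: rem g s); split=> [||l].
- by rewrite /= size_rem // sz.
- by rewrite !big_cons mulrA -def_g def_x (big_rem g).
- by rewrite !inE => /or3P[/eqP->|/eqP->|/mem_rem/sU].
Qed.

(** * Leading coefficients of the factors of [f] *)

(** The shift [z + c] preserves products and leading coefficients, so the edge argument transfers to
    [f]. *)
Lemma prime_divides_one_lead (f A B : {poly int}) (n p k j : nat) (c : int) :
    f = A * B -> size f = n.+1 -> prime p -> (0 < j <= n)%N -> (0 < k)%N ->
    coprime k j -> logn p (absz (lead_coef f)) = k ->
    vp p f^`N(n - j).[c] = 0%E ->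
    (forall t : nat, (1 <= t <= j.-1)%N ->
       (k%:R%:E / j%:R%:E < vp p f^`N(n - t).[c] / (j - t)%N%:R%:E)%E) ->
  ~ ((p%:Z %| lead_coef A)%Z /\ (p%:Z %| lead_coef B)%Z).
Proof.
move=> def_f sf p_pr jn k0 co_kj v_lead vj slope.
have size_shift : size ('X + c%:P : {poly int}) = 2%N := size_XaddC c.
pose sh (g : {poly int}) := g \Po ('X + c%:P).
have lead_sh g : lead_coef (sh g) = lead_coef g.
  by rewrite lead_coef_comp ?size_shift // lead_coefXaddC expr1n mulr1.
have sh_AB : sh A * sh B = sh f by rewrite def_f /sh rmorphM.
have size_sh : size (sh f) = n.+1 by rewrite size_comp_poly2.
rewrite -(lead_sh A) -(lead_sh B).
apply: (newton_edge_unsplittable p_pr jn k0 co_kj); rewrite sh_AB ?lead_sh //.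
  by rewrite coef_taylor_shift vp_eq0_ndvd.
move=> i sh_i; case/andP: jn => j0 jn.
have le_in : (i <= n)%N.
  by apply: contra_neqT sh_i; rewrite -ltnNge -size_sh => /(nth_default 0).
have [->|ne_in] := eqVneq i n.
  by rewrite /vcoef -[X in (sh f)`_X]/(n.+1.-1) -size_sh -lead_coefE lead_sh v_lead.
have [t def_n t0] : exists2 t, n = (i + t)%N & (0 < t)%N.
  by exists (n - i)%N; lia.
(* For [t >= j] the edge line has height at most 0, so any valuation suffices; [slope] covers the
   rest. *)
have [le_jt|lt_tj] := leqP j t.
  apply: leq_trans (leq_addl _ _); rewrite (mulnC j) -mulnDr leq_mul2l.
  by rewrite def_n addnC leq_add2l le_jt orbT.
have : (k * (j - t) < j * vcoef p (sh f) i)%N.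
  have def_i : (n - t)%N = i by lia.
  apply: vp_slope_lt => //; first by rewrite subn_gt0.
  by rewrite coef_taylor_shift -{1}def_i slope //; lia.
have : (k * (j - t) + k * t = j * k)%N by rewrite -mulnDr mulnC; congr muln; lia.
by rewrite def_n mulnDr; lia.
Qed.

Lemma prime_power_prod_pdiv (r : nat) (p k : 'I_r -> nat) (a : nat) :
    (forall l, prime (p l)) -> (a %| \prod_(l < r) p l ^ k l)%N -> a != 1%N ->
  exists l, (p l %| a)%N.
Proof.
move=> p_pr dvd_a a1.
have a0 : (0 < a)%N.
  by apply: dvdn_gt0 dvd_a; rewrite prodn_gt0 // => l; rewrite expn_gt0 prime_gt0.
have q_pr : prime (pdiv a) by rewrite pdiv_prime // ltn_neqAle eq_sym a1.
have := dvdn_trans (pdiv_dvd a) dvd_a; rewrite Euclid_dvd_prod // big_orE.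
case/existsP => l /=; rewrite Euclid_dvdX // => /andP[].
by rewrite dvdn_prime2 // => /eqP def_q _; exists l; rewrite -def_q pdiv_dvd.
Qed.

Lemma unit_lead_factor_trivial (f g h : {poly int}) (m : nat) :
    f = g * h -> f`_0 != 0 -> height f + 2%:R <= m%:R ->
    absz (lead_coef g) = 1%N -> (1 < size g)%N -> (1 < size h)%N ->
  `|f.[m%:Z]%:~R| / (pdiv (absz f.[m%:Z]))%:R <= `|(lead_coef f)%:~R| :> rat ->
  False.
Proof.
move=> def_f a0 m_ge lg sg sh.
have := lead_lt_eval def_f a0 sg m_ge.
have := lead_lt_eval (etrans def_f (mulrC g h)) a0 sh m_ge.
rewrite def_f hornerM lead_coefM -!abszE !ltz_nat lg abszM => lt_h lt_g.
set q := pdiv _; have q_le : (q <= absz (g.[m%:Z]))%N.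
  by rewrite pdiv_min_dvd ?dvdn_mulr.
have q0 : (0 < q)%N by exact: pdiv_gt0.
rewrite -!intr_norm -!abszE !abszM lg mul1n ler_pdivrMr ?ltr0n //.
rewrite -!pmulrn -natrM ler_nat leqNgt => /negP; apply.
rewrite mulnC; apply: leq_ltn_trans (leq_mul q_le (leqnn _)) _.
by rewrite ltn_pmul2l // (leq_ltn_trans _ lt_g).
Qed.

(** * Counting the nonunit factors *)

Theorem theorem2 (f : {poly int}) (n : nat) (m r : nat)
    (p k : 'I_r -> nat)
    (size_f : size f = n.+1)
    (prim_f : primitive_poly f)
    (a0an_neq0 : f`_0 * f`_n != 0)
    (m_gt0 : (0 < m)%N)
    (m_ge : height f + 2%:R <= m%:R)
    (r_gt0 : (0 < r)%N)
    (k_gt0 : forall i, (0 < k i)%N)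
    (p_prime : forall i, prime (p i))
    (p_inj : injective p)
    (sn_eq : f^`N(n).[m%:Z] = (\prod_(i < r) p i ^ k i)%N%:Z \/
             f^`N(n).[m%:Z] = - (\prod_(i < r) p i ^ k i)%N%:Z)
    (hj : forall i : 'I_r, exists j : nat,
       [/\ (0 < j <= n)%N,
           vp (p i) f^`N(n - j).[m%:Z] = 0%E /\ coprime (k i) j &
           (1 < j)%N -> forall t : nat, (1 <= t <= j.-1)%N ->
             ((k i)%:R%:E / j%:R%:E <
                vp (p i) f^`N(n - t).[m%:Z] / (j - t)%N%:R%:E)%E])
    (hq : `|f^`N(0).[m%:Z]%:~R / (pdiv `|f^`N(0).[m%:Z]|%N)%:R|
            <= `|f^`N(n).[m%:Z]%:~R| :> rat) :
  (exists s : seq {poly int},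
     [/\ (size s <= r)%N,
         forall g, g \in s -> irreducible_elt g &
         f = \prod_(g <- s) g])
  /\ (r = 1%N -> irreducible_elt f).
Proof.
have lead_f : f^`N(n).[m%:Z] = lead_coef f.
  have size_shift : size ('X + m%:Z%:P : {poly int}) = 2%N := size_XaddC m%:Z.
  rewrite -coef_taylor_shift -[X in _`_X]/(n.+1.-1) -size_f.
  rewrite -(size_comp_poly2 f size_shift) -lead_coefE lead_coef_comp ?size_shift //.
  by rewrite lead_coefXaddC expr1n mulr1.
have abs_lead : absz (lead_coef f) = (\prod_(i < r) p i ^ k i)%N.
  by rewrite -lead_f; case: sn_eq => ->; rewrite ?abszN absz_nat.
rewrite lead_f nderivn0 in hq.
have a0 : f`_0 != 0 by apply: contraNneq a0an_neq0 => ->; rewrite mul0r.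
have f0 : f != 0 by rewrite -size_poly_gt0 size_f.
have n_gt0 : (0 < n)%N.
  by have [j [/andP[j0 jn] _ _]] := hj (Ordinal r_gt0); apply: leq_trans jn.
have fU : f \isn't a GRing.unit.
  by rewrite poly_unitE size_f eqSS gtn_eqF.
have one_lead i A B : f = A * B ->
    ~ (((p i)%:Z %| lead_coef A)%Z /\ ((p i)%:Z %| lead_coef B)%Z).
  move=> def_f; have [j [jn [vj co_kj] slope]] := hj i.
  apply: (prime_divides_one_lead def_f size_f (p_prime i) jn (k_gt0 i) co_kj _ vj).
    by rewrite abs_lead logn_prime_power_prod.
  (* For [j <= 1] the range of [t] is empty. *)
  by move=> t t_j; apply: (slope _ t t_j); case: (j) t_j => [|[|?]] /andP[] //; case: t.
have bound (s : seq {poly int}) : f = \prod_(g <- s) g ->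
    (forall g, g \in s -> g \isn't a GRing.unit) -> (size s <= r)%N.
  move=> def_f sU; rewrite leqNgt; apply/negP => lt_rs.
  rewrite (big_nth 0) big_mkord in def_f.
  pose G (l : 'I_(size s)) := s`_l.
  pose H (l : 'I_(size s)) := \prod_(l' < size s | l' != l) G l'.
  have def_fl l : f = G l * H l by rewrite def_f (bigD1 l).
  have sU_l (l : 'I_(size s)) : G l \isn't a GRing.unit.
    by apply: sU; rewrite mem_nth.
  have size_sl (l : 'I_(size s)) : (1 < size (G l))%N.
    exact: nonunit_factor_size prim_f (def_fl l) (sU_l l).
  (* Pigeonhole: otherwise choose for each factor a [p i] dividing its leading coefficient;
     [one_lead] makes the choice injective, yet there are more than [r] factors. *)
  have [l unit_l] : exists l : 'I_(size s), forall i, ~~ (p i %| absz (lead_coef (G l)))%N.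
    apply: NNPP => no_l.
    have /fin_all_exists[phi dvd_phi] (l : 'I_(size s)) :
        exists i, (p i %| absz (lead_coef (G l)))%N.
      apply: NNPP => no_i; apply: no_l; exists l => i.
      by apply/negP => dvd_i; apply: no_i; exists i.
    suff /leq_card : injective phi by rewrite !card_ord leqNgt lt_rs.
    move=> l l' eq_phi; apply/eqP; apply: contraT => ne_l.
    case: (one_lead (phi l) _ _ (def_fl l)); rewrite !dvdzE !absz_nat.
    split; first exact: dvd_phi.
    rewrite /H lead_coef_prod (bigD1 l') 1?eq_sym //= abszM eq_phi.
    by rewrite dvdn_mulr ?dvd_phi.
  have lead_l : absz (lead_coef (G l)) = 1%N.
    apply/eqP; apply: contraT => ne1.
    have dvd_l : (absz (lead_coef (G l)) %| \prod_(i < r) p i ^ k i)%N.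
      by rewrite -abs_lead (def_fl l) lead_coefM abszM dvdn_mulr.
    have [i dvd_i] := prime_power_prod_pdiv p_prime dvd_l ne1.
    by have := unit_l i; rewrite dvd_i.
  apply: (unit_lead_factor_trivial (def_fl l) a0 m_ge lead_l (size_sl l)).
    (* As [size s > r >= 1], the cofactor [H l] contains another nonunit and so is nonconstant. *)
    have [l' ne_l] : exists l', l' != l.
      apply/existsP; rewrite -[X in is_true X]negbK negb_exists; apply/forallP => eq_l.
      have : (1 < #|'I_(size s)|)%N by rewrite card_ord (leq_ltn_trans r_gt0).
      rewrite ltnNge => /negP; apply; apply/card_le1_eqP => x y _ _.
      by have := eq_l x; have := eq_l y; rewrite !negbK => /eqP-> /eqP->.
    apply: (@nonunit_factor_size f _ (G l)) => //; first by rewrite mulrC -def_fl.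
    rewrite /H (bigD1 l') //= unitrM negb_and sU_l //.
  by move: hq; rewrite normrM normfV (ger0_norm (ler0n _ _)).
have [s [size_s irr_s def_f]] := irreducible_factorization f0 fU bound.
split; first by exists s.
move=> r1; rewrite r1 in size_s.
case: s size_s irr_s def_f => [|g [|//]] _ irr_s.
  by rewrite big_nil => f1; rewrite f1 unitr1 in fU.
by rewrite big_seq1 => ->; apply: irr_s; rewrite mem_head.
Qed.
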